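(* Let $N\ge 2$, and let $\mathcal{L}(\chi,\lambda)=F(\chi)+\lambda^T c(\chi)$ be the Lagrangian of the problem $\min_\chi F(\chi)=\frac12\sum_{i=1}^N t_i^2$ subject to $c(\chi)=0$ associated with the dynamical system $\dot x=f(x(t))$ (all objects as defined in the context). Then the Hessian of the Lagrangian with respect to $\chi=[x_0^1,t_1,\ldots,x_0^N,t_N]^T$ is block diagonal, $$\nabla_\chi^2\mathcal{L}(\chi,\lambda)=\begin{bmatrix}\begin{bmatrix}A_1 & v_1 \\ v_1^T & \alpha_1\end{bmatrix} & & \\ & \ddots & \\ & & \begin{bmatrix}A_N & v_N \\ v_N^T & \alpha_N\end{bmatrix}\end{bmatrix}\in\mathbb{R}^{N(n+1)\times N(n+1)},$$ with $A_i\in\mathbb{R}^{n\times n}$, $v_i\in\mathbb{R}^n$, $\alpha_i\in\mathbb{R}$ for $1\le i\le N$, where, writing $x(t_i)=\Phi(t_i,x_0^i)$, $$v_i=-\left(\frac{\partial f(x(t_i))}{\partial x}S(t_i,x_0^i)\right)^T\lambda_i,\quad 1\le i\le N-1,$$ $$\alpha_i=-\left(\frac{\partial f(x(t_i))}{\partial x}f(x(t_i))\right)^T\lambda_i+1,\quad 1\le i\le N-1,$$ $$A_1=\lambda_I E_I-\frac{\partial^2\Phi(t_1,x_0^1)}{\partial {x_0^1}^2}\circ\lambda_1,$$ $$A_i=-\frac{\partial^2\Phi(t_i,x_0^i)}{\partial {x_0^i}^2}\circ\lambda_i,\quad 2\le i\le N-1,$$ and $$A_N=\lambda_U S(t_N,x_0^N)^T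 E_U S(t_N,x_0^N)+\lambda_U\frac{\partial^2\Phi(t_N,x_0^N)}{\partial {x_0^N}^2}\circ E_U\left(\Phi(t_N,x_0^N)-c_U\right),$$ $$v_N=\lambda_U\left(\frac{\partial f(x(t_N))}{\partial x}S(t_N,x_0^N)\right)^T E_U\left(\Phi(t_N,x_0^N)-c_U\right)+\lambda_U S(t_N,x_0^N)^T E_U f(x(t_N)),$$ $$\alpha_N=\lambda_U\left(\frac{\partial f(x(t_N))}{\partial x}f(x(t_N))\right)^T E_U\left(\Phi(t_N,x_0^N)-c_U\right)+\lambda_U f(x(t_N))^T E_U f(x(t_N))+1.$$
   Context: Let $f:\mathbb{R}^n\to\mathbb{R}^n$ be continuously differentiable, and let $\Phi:\mathbb{R}\times\mathbb{R}^n\to\mathbb{R}^n$ be the flow of $\dot x=f(x(t))$, i.e. $\Phi(0,x_0)=x_0$ and $\Phi(t,x_0)=x(t)$ for the solution $x$ with initial state $x_0$. The sensitivity function is $S(t,x_0)=\frac{\partial\Phi(t,x_0)}{\partial x_0}\in\mathbb{R}^{n\times n}$ (entry $(j,k)$ is $\partial x_j(t)/\partial x_{0,k}$), and $\frac{\partial f}{\partial x}$ is the usual $n\times n$ Jacobian matrix of $f$. $E_I,E_U\in\mathbb{R}^{n\times n}$ are symmetric positive definite matrices, $c_I,c_U\in\mathbb{R}^n$, and $\|v\|_E^2=v^TEv$. The parameter vector is $\chi=[x_0^1,t_1,x_0^2,t_2,\ldots,x_0^N,t_N]^T\in\mathbb{R}^{N(n+1)}$ with $x_0^i\in\mathbb{R}^n$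 (initial state of the $i$th solution segment) and $t_i\ge 0$ (its length). The objective is $F(\chi)=\frac12\sum_{i=1}^N t_i^2$ and the constraint vector is $$c(\chi)=\begin{bmatrix}\frac12\left(\|x_0^1-c_I\|_{E_I}^2-1\right) \\ x_0^2-\Phi(t_1,x_0^1) \\ \vdots \\ x_0^N-\Phi(t_{N-1},x_0^{N-1}) \\ \frac12\left(\|\Phi(t_N,x_0^N)-c_U\|_{E_U}^2-1\right)\end{bmatrix}\in\mathbb{R}^{(N-1)n+2}.$$ The Lagrange multiplier vector is $\lambda=[\lambda_I,\lambda_1,\ldots,\lambda_{N-1},\lambda_U]^T\in\mathbb{R}^{(N-1)n+2}$ with $\lambda_I,\lambda_U\in\mathbb{R}$ and $\lambda_i\in\mathbb{R}^n$. Standing assumption: the objective and the constraints are twice continuously differentiable (in particular so is $\Phi$). $\frac{\partial^2\Phi(t,x_0)}{\partial x_0^2}\in\mathbb{R}^{n\times n\times n}$ is the tensor of second derivatives of the components of $\Phi$ with respect to $x_0$, and for $w\in\mathbb{R}^n$ the symbol $\circ$ denotes contraction over the component index: $\frac{\partial^2\Phi}{\partial x_0^2}\circ w=\sum_{k=1}^n w_k\frac{\partial^2\Phi_k}{\partial x_0^2}\in\mathbb{R}^{n\times n}$. *)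

(* Defs.v *)
From mathcomp Require Import all_boot all_order all_algebra.
From mathcomp Require Import all_classical all_reals all_analysis.
Import Order.TTheory GRing.Theory Num.Theory.
Import numFieldNormedType.Exports.

Set Implicit Arguments.
Unset Strict Implicit.
Unset Printing Implicit Defensive.

Local Open Scope ring_scope.

(* In finite dimension, continuity of x |-> 'd f x is the same as continuity of
   x |-> 'D_v f x for every fixed direction v. *)
Definition C1 (R : realType) (V W : normedModType R) (f : V -> W) : Prop :=
  (forall x, differentiable f x) /\ (forall v, continuous ('D_v f)).

Definition C2 (R : realType) (V W : normedModType R) (f : V -> W) : Prop :=
  C1 f /\ (forall v, C1 ('D_v f)).

(* Column-vector convention: the entry (j, k) is the partial derivative of the
   j-th component along the k-th coordinate (the transpose of MathComp-Analysis'
   'J, which acts on row vectors). *)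
Definition jacobian_mx (R : realType) (m n : nat)
    (g : 'cV[R]_m -> 'cV[R]_n) (x : 'cV[R]_m) : 'M[R]_(n, m) :=
  \matrix_(j, k) 'D_(delta_mx k 0) (fun y => g y j 0) x.

Definition hessian (R : realType) (m : nat) (g : 'cV[R]_m -> R)
    (x : 'cV[R]_m) : 'M[R]_m :=
  \matrix_(j, k) 'D_(delta_mx j 0) ('D_(delta_mx k 0) g) x.

(* The n x n x n tensor of second derivatives, indexed by the component k. *)
Definition hessian_tensor (R : realType) (n : nat)
    (g : 'cV[R]_n -> 'cV[R]_n) (x : 'cV[R]_n) (k : 'I_n) : 'M[R]_n :=
  hessian (fun y => g y k 0) x.

Definition tensor_contract (R : realType) (n : nat) (T : 'I_n -> 'M[R]_n)
    (w : 'cV[R]_n) : 'M[R]_n :=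
  \sum_(k < n) w k 0 *: T k.

Definition dotv (R : realType) (n : nat) (u v : 'cV[R]_n) : R :=
  (u^T *m v) 0 0.

Definition sqnorm_mx (R : realType) (n : nat) (E : 'M[R]_n) (v : 'cV[R]_n) : R :=
  (v^T *m E *m v) 0 0.

Definition sym_posdef (R : realType) (n : nat) (E : 'M[R]_n) : Prop :=
  E^T = E /\ (forall v : 'cV[R]_n, v != 0 -> 0 < sqnorm_mx E v).

Definition is_flow (R : realType) (n : nat) (f : 'cV[R]_n -> 'cV[R]_n)
    (Phi : R -> 'cV[R]_n -> 'cV[R]_n) : Prop :=
  forall x0 : 'cV[R]_n, Phi 0 x0 = x0 /\
    (forall t : R, is_derive t (1 : R) (fun s => Phi s x0) (f (Phi t x0))).

Definition sensitivity (R : realType) (n : nat)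
    (Phi : R -> 'cV[R]_n -> 'cV[R]_n) (t : R) (x0 : 'cV[R]_n) : 'M[R]_n :=
  jacobian_mx (Phi t) x0.

(* K is the number of transitions between consecutive segments, so that the
   number of segments is N = K.+1.  Segments are indexed by 'I_K.+1, from 0;
   transition i : 'I_K goes from segment [seg_from i] to segment [seg_next i]. *)
Definition seg_from (K : nat) (i : 'I_K) : 'I_K.+1 := widen_ord (leqnSn K) i.
Definition seg_next (K : nat) (i : 'I_K) : 'I_K.+1 := lift ord0 i.

(* [x_0^1; t_1; ...; x_0^N; t_N], as a block column with N blocks of height n + 1 *)
Notation param_vec R n K := 'cV[R]_(\sum_(i < K.+1) (n + 1)).

(* [lambda_I; lambda_1; ...; lambda_{N-1}; lambda_U] *)
Notation multiplier_vec R n K := 'cV[R]_(1 + (\sum_(i < K) n + 1)).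

Definition seg_init (R : realType) (n K : nat) (chi : param_vec R n K)
    (i : 'I_K.+1) : 'cV[R]_n :=
  usubmx (submxcol chi i).

Definition seg_len (R : realType) (n K : nat) (chi : param_vec R n K)
    (i : 'I_K.+1) : R :=
  (dsubmx (submxcol chi i)) 0 0.

Definition lamI (R : realType) (n K : nat) (lam : multiplier_vec R n K) : R :=
  (usubmx lam) 0 0.

Definition lamT (R : realType) (n K : nat) (lam : multiplier_vec R n K)
    (i : 'I_K) : 'cV[R]_n :=
  submxcol (usubmx (dsubmx lam)) i.

Definition lamU (R : realType) (n K : nat) (lam : multiplier_vec R n K) : R :=
  (dsubmx (dsubmx lam)) 0 0.

Definition objective (R : realType) (n K : nat) (chi : param_vec R n K) : R :=
  2^-1 * \sum_(i < K.+1) seg_len chi i ^+ 2.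

Definition constraint_vec (R : realType) (n K : nat)
    (Phi : R -> 'cV[R]_n -> 'cV[R]_n) (EI EU : 'M[R]_n) (cI cU : 'cV[R]_n)
    (chi : param_vec R n K) : multiplier_vec R n K :=
  let x0 i := seg_init chi i in
  let xt i := Phi (seg_len chi i) (x0 i) in
  col_mx (2^-1 * (sqnorm_mx EI (x0 ord0 - cI) - 1))%:M
    (col_mx (\mxcol_(i < K) (x0 (seg_next i) - xt (seg_from i)))
            (2^-1 * (sqnorm_mx EU (xt ord_max - cU) - 1))%:M).

Definition lagrangian (R : realType) (n K : nat)
    (Phi : R -> 'cV[R]_n -> 'cV[R]_n) (EI EU : 'M[R]_n) (cI cU : 'cV[R]_n)
    (chi : param_vec R n K) (lam : multiplier_vec R n K) : R :=
  objective chi + dotv lam (constraint_vec Phi EI EU cI cU chi).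

(* Main.v *)
Require Import Defs.
From HB Require Import structures.
From mathcomp Require Import all_boot all_order all_algebra.
From mathcomp Require Import all_classical all_reals all_analysis.
Import Order.TTheory GRing.Theory Num.Theory.
Import numFieldNormedType.Exports.

Set Implicit Arguments.
Unset Strict Implicit.
Unset Printing Implicit Defensive.

Local Open Scope ring_scope.

(** The Lagrangian is separable: with z_p = [x_0^p; t_p], it is a sum over the
    segments p of a function of z_p alone, because a transition constraint
    x_0^{i+1} - Phi(t_i, x_0^i) is itself a difference of a function of z_{i+1}
    and a function of z_i.  Hence the Hessian is block diagonal.  In each block,
    the time derivatives of G(x, t) = Phi(t, x) follow from d_t G = f o G, whose
    chain rule gives D (d_t G) = Df DG; the lower left corner then follows from
    the symmetry of second derivatives.  That G is C^2 is read off the first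
    transition constraint, which exists because N >= 2. *)

(** * Directional derivatives under affine and linear maps *)

Section DirectionalDerivative.
Context {R : numFieldType} {V V' W W' : normedModType R}.

(** The hypothesis makes the two difference quotients the same function of [h]. It asks for affinity
    only at [a] along [v], which covers linear maps, lines and slices with frozen time or state
    alike. *)
Lemma derive_comp_affine (g : V' -> W) (l : V -> V') a v w :
  (forall h, l (h *: v + a) = h *: w + l a) ->
  'D_v (g \o l) a = 'D_w g (l a).
Proof.
move=> hl; rewrite /derive.
suff -> : (fun h => h^-1 *: (((g \o l) \o shift a) (h *: v) - (g \o l) a)) =
  (fun h => h^-1 *: ((g \o shift (l a)) (h *: w) - g (l a))) by [].
by apply/funext => h /=; rewrite hl.
Qed.

Lemma is_derive_comp_affine (g : V' -> W) (l : V -> V') a v w dg :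
  (forall h, l (h *: v + a) = h *: w + l a) ->
  is_derive (l a) w g dg -> is_derive a v (g \o l) dg.
Proof.
move=> hl [dg1 dg2]; apply: DeriveDef; last by rewrite (derive_comp_affine _ hl).
rewrite /derivable (_ : (fun _ => _) =
  fun h => h^-1 *: ((g \o shift (l a)) (h *: w) - g (l a)))//.
by apply/funext => h /=; rewrite hl.
Qed.

(** [P] commutes with difference quotients, and its continuity carries the limit over. *)
Lemma is_derive_linear_comp (f : V -> W) (P : {linear W -> W'}) (x v : V) df :
  continuous P -> is_derive x v f df -> is_derive x v (P \o f) (P df).
Proof.
move=> cP [d1 d2].
have h : ((fun h => h^-1 *: (((P \o f) \o shift x) (h *: v) - (P \o f) x)) @ 0^'
    --> P df)%classic.
  rewrite (_ : (fun _ => _) =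
    P \o (fun h => h^-1 *: ((f \o shift x) (h *: v) - f x))); last first.
    by apply/funext => h; rewrite [RHS]/= -raddfB -linearZ.
  by rewrite -d2; exact: cvg_comp d1 (cP _).
apply: DeriveDef; first by apply/cvg_ex; exists (P df).
exact: cvg_lim h.
Qed.

End DirectionalDerivative.

(** Reduces to one real variable, where the mean value theorem is available. *)
Lemma is_derive_line (R : numFieldType) (V W : normedModType R) (f : V -> W)
    (u w : V) (s : R) :
  derivable f (s *: u + w) u ->
  is_derive s (1 : R) (fun r => f (r *: u + w)) ('D_u f (s *: u + w)).
Proof.
move=> df; pose l (r : R) := r *: u + w.
have hl h : l (h *: 1 + s) = h *: u + l s.
  by rewrite /l scalerDl -addrA [h *: 1]mulr1.
exact: (is_derive_comp_affine hl (derivableP df)).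
Qed.

(** Expanding the argument on the standard basis writes [f] as a finite sum of coordinates times
    fixed vectors. *)
Lemma linear_cV_differentiable (R : realType) (m : nat) (W : normedModType R)
    (f : {linear 'cV[R]_m -> W}) x : differentiable f x.
Proof.
have -> : f = \sum_(j < m) (fun z : 'cV[R]_m => z j 0 *: f (delta_mx j 0)) :> (_ -> _).
  apply/funext => z; rewrite fct_sumE {1}[z]matrix_sum_delta linear_sum.
  by apply: eq_bigr => j _; rewrite linear_sum big_ord1 linearZ.
apply: differentiable_sum => j; apply: differentiableZl.
exact: differentiable_coord.
Qed.

Lemma linear_cV_continuous (R : realType) (m : nat) (W : normedModType R)
    (f : {linear 'cV[R]_m -> W}) : continuous f.
Proof. by move=> x; exact/differentiable_continuous/linear_cV_differentiable. Qed.

(** * Stability of C^1 and C^2 under composition with linear maps *)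

Section LinearComposition.
Context {R : realType}.

Lemma derive_precomp (V V' W : normedModType R) (g : V' -> W)
    (l : {linear V -> V'}) v : 'D_v (g \o l) = 'D_(l v) g \o l.
Proof.
apply/funext => x /=; apply: derive_comp_affine => h.
by rewrite linearD linearZ.
Qed.

Lemma C1_precomp (m : nat) (V W : normedModType R)
    (g : V -> W) (l : {linear 'cV[R]_m -> V}) : C1 g -> C1 (g \o l).
Proof.
move=> [d c]; split=> [x|v].
  by apply: differentiable_comp; [exact: linear_cV_differentiable|exact: d].
rewrite derive_precomp => x.
by apply: continuous_comp; [exact: linear_cV_continuous|exact: c].
Qed.

Lemma C2_precomp (m : nat) (V W : normedModType R)
    (g : V -> W) (l : {linear 'cV[R]_m -> V}) : C2 g -> C2 (g \o l).
Proof.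
move=> [c1 c2]; split=> [|v]; first exact: C1_precomp.
by rewrite derive_precomp; exact: C1_precomp.
Qed.

Lemma derive_postcomp (V : normedModType R) (m : nat)
    (W : normedModType R) (g : V -> 'cV[R]_m) (P : {linear 'cV[R]_m -> W}) v :
  (forall x, differentiable g x) -> 'D_v (P \o g) = P \o 'D_v g.
Proof.
move=> d; apply/funext => x.
by case: (is_derive_linear_comp (@linear_cV_continuous _ _ _ P)
  (derivableP (diff_derivable (v := v) (d x)))).
Qed.

Lemma C1_postcomp (V : normedModType R) (m : nat)
    (W : normedModType R) (g : V -> 'cV[R]_m) (P : {linear 'cV[R]_m -> W}) :
  C1 g -> C1 (P \o g).
Proof.
move=> [d c]; split=> [x|v].
  by apply: differentiable_comp; [exact: d|exact: linear_cV_differentiable].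
rewrite derive_postcomp// => x.
by apply: continuous_comp; [exact: c|exact: linear_cV_continuous].
Qed.

Lemma C2_postcomp (V : normedModType R) (m : nat)
    (W : normedModType R) (g : V -> 'cV[R]_m) (P : {linear 'cV[R]_m -> W}) :
  C2 g -> C2 (P \o g).
Proof.
move=> [c1 c2]; split=> [|v]; first exact: C1_postcomp.
rewrite (derive_postcomp P v c1.1).
exact: (C1_postcomp P (c2 v)).
Qed.

End LinearComposition.

(** * Symmetry of second derivatives *)

(* Exchanging [u] and [v] leaves the left-hand side unchanged, whence the symmetry
   of second derivatives in the limit h -> 0. *)
Lemma second_difference_MVT (R : realType) (V : normedModType R) (f : V -> R)
    (u v z : V) (h : R) :
  (forall x, derivable f x u) -> (forall x, derivable ('D_u f) x v) -> 0 < h ->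
  exists s r, [/\ 0 < s < h, 0 < r < h &
    f (h *: u + (h *: v + z)) - f (h *: u + z) - f (h *: v + z) + f z
    = h ^+ 2 * 'D_v ('D_u f) (r *: v + (s *: u + z))].
Proof.
move=> du dvu h0.
have ctn (g dg : R -> R) : (forall x, is_derive x (1 : R) g (dg x)) ->
    {within `[0, h], continuous g}%classic.
  move=> dg1; apply: continuous_subspaceT => x.
  by apply/differentiable_continuous/derivable1_diffP; case: (dg1 x).
(* [g1] is the increment of [f] over the step [h *: v], seen as a function of [s]. The mean value
   theorem in [s] leaves an increment of ['D_u f], to which it applies again in [r]. *)
pose g1 := (fun s => f (s *: u + (h *: v + z))) - (fun s => f (s *: u + z)).
pose dg1 s := 'D_u f (s *: u + (h *: v + z)) - 'D_u f (s *: u + z).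
have d1 x : is_derive x (1 : R) g1 (dg1 x).
  by apply: is_deriveB; apply: is_derive_line.
have [s /[!in_itv]/= sh e1] := MVT h0 (fun x _ => d1 x) (ctn _ _ d1).
pose g2 := fun r => 'D_u f (r *: v + (s *: u + z)).
pose dg2 r := 'D_v ('D_u f) (r *: v + (s *: u + z)).
have d2 x : is_derive x (1 : R) g2 (dg2 x) by apply: is_derive_line.
have [r /[!in_itv]/= rh e2] := MVT h0 (fun x _ => d2 x) (ctn _ _ d2).
exists s, r; split=> //.
move: e1 e2; rewrite /g1 /dg1 /g2 /dg2 !subr0.
rewrite -![(_ - _ : _ -> _) _]/(_ - _) /= !scale0r !add0r.
rewrite [s *: u + (h *: v + z)]addrCA => + e; rewrite {}e => e.
rewrite expr2 -mulrA mulrC -[h * _]mulrC -e.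
by rewrite opprB !addrA [in RHS]addrAC.
Qed.

(** Both mixed derivatives, taken at suitable points near [z], equal the same second difference
    divided by [h ^+ 2]. By continuity each is within [e / 2] of its value at [z], so the two values
    differ by at most any [e > 0]. *)
Lemma derive_comm (R : realType) (V : normedModType R) (f : V -> R) (u v z : V) :
  C2 f -> 'D_v ('D_u f) z = 'D_u ('D_v f) z.
Proof.
move=> [[d _] c2].
have der w x : derivable f x w by exact/diff_derivable.
have der2 w w' x : derivable ('D_w f) x w'.
  by apply/diff_derivable; case: (c2 w).
have ctn w w' : continuous ('D_w' ('D_w f)) by case: (c2 w).
apply/eqP; rewrite -subr_eq0 -normr_le0; apply/ler_addgt0Pl => e e0.
rewrite addr0.
have near_pt w w' : exists2 k : R, 0 < k & forall s r, 0 < s < k -> 0 < r < k ->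
    `|'D_w' ('D_w f) z - 'D_w' ('D_w f) (r *: w' + (s *: w + z))| < e / 2.
  have /cvgrPdist_lt /(_ (e / 2)) := ctn w w' z.
  rewrite divr_gt0// => /(_ isT) /nbhs_normP[k /= k0 hk].
  (* The summand 1 keeps the denominator positive when both directions vanish, and makes the bound
     on the displacement strict. *)
  have n0 : 0 < `|w| + `|w'| + 1 by rewrite ltr_wpDl// addr_ge0.
  exists (k / (`|w| + `|w'| + 1)) => [|s r /andP[s0 sk] /andP[r0 rk]].
    by rewrite divr_gt0.
  apply: hk => /=; rewrite addrA opprD addrCA subrr addr0 normrN.
  rewrite (le_lt_trans (ler_normD _ _))// !normrZ !gtr0_norm//.
  have hx (x y : R) : 0 <= y -> x < k / (`|w| + `|w'| + 1) ->
      x * y <= k / (`|w| + `|w'| + 1) * y.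
    by move=> y0 xk; rewrite ler_wpM2r// ltW.
  rewrite (le_lt_trans (lerD (hx _ _ _ rk) (hx _ _ _ sk)))//.
  rewrite -mulrDr mulrAC -mulrA gtr_pMr// ltr_pdivrMr// mul1r.
  by rewrite [`|w'| + _]addrC ltrDl.
have [k1 k10 h1] := near_pt u v.
have [k2 k20 h2] := near_pt v u.
pose h := Num.min k1 k2.
have h0 : 0 < h by rewrite lt_min k10.
have hk1 s : 0 < s < h -> 0 < s < k1.
  by move=> /andP[-> /lt_le_trans->]//; rewrite ge_min lexx.
have hk2 s : 0 < s < h -> 0 < s < k2.
  by move=> /andP[-> /lt_le_trans->]//; rewrite ge_min lexx orbT.
have [s [r [/hk1 sh /hk1 rh e1]]] := second_difference_MVT z (der u) (der2 u v) h0.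
have [s' [r' [/hk2 sh' /hk2 rh' e2]]] :=
  second_difference_MVT z (der v) (der2 v u) h0.
(* The two second differences agree up to the order of their middle terms; the factor [h ^+ 2] then
   cancels. *)
have {e1 e2} e12 : 'D_v ('D_u f) (r *: v + (s *: u + z)) =
    'D_u ('D_v f) (r' *: u + (s' *: v + z)).
  apply: (@mulfI _ (h ^+ 2)); first by rewrite expf_neq0// gt_eqF.
  apply: etrans (esym e1) (etrans _ e2).
  by rewrite [h *: v + (h *: u + z)]addrCA (addrAC (f (h *: u + (h *: v + z)))).
rewrite [e]splitr -(subrKA ('D_v ('D_u f) (r *: v + (s *: u + z)))).
apply: le_trans (ler_normD _ _) _; apply: lerD; apply: ltW; first exact: h1.
by rewrite e12 distrC; exact: h2.
Qed.

(** * Calculus of vector-valued maps, dot products and quadratic forms *)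

(** Bundles a proof of linearity, so that the lemmas on linear maps apply to plain functions such as
    coordinate projections and block embeddings. *)
Definition linear_pack (R : pzRingType) (U V : lmodType R) (f : U -> V)
    (hf : linear f) : {linear U -> V} :=
  HB.pack f (GRing.isLinear.Build _ _ _ _ f hf).

Section MatrixValued.
Context {R : realType} {V : normedModType R}.

Lemma is_derive_coord m n (F : V -> 'M[R]_(m, n)) x v dF i j :
  is_derive x v F dF -> is_derive x v (fun y => F y i j) (dF i j).
Proof.
move=> [d1 d2]; apply: DeriveDef; first exact: (derivable_mxP F x v).1.
by rewrite -d2 derive_mx// mxE.
Qed.

Lemma is_derive_dotv n (F H : V -> 'cV[R]_n) x v dF dH :
  is_derive x v F dF -> is_derive x v H dH ->
  is_derive x v (fun y => dotv (F y) (H y)) (dotv dF (H x) + dotv (F x) dH).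
Proof.
move=> hF hH.
have -> : (fun y => dotv (F y) (H y)) =
    \sum_(k < n) ((fun y => F y k 0) * (fun y => H y k 0)).
  apply/funext => y; rewrite fct_sumE /dotv mxE.
  by apply: eq_bigr => k _; rewrite mxE.
apply: is_derive_eq.
  apply: is_derive_sum => k.
  exact: is_deriveM (is_derive_coord _ _ hF) (is_derive_coord _ _ hH).
rewrite /dotv !mxE -big_split; apply: eq_bigr => k _ /=.
by rewrite !mxE addrC; congr (_ + _); exact: mulrC.
Qed.

Lemma is_derive_mulmx m n (M : 'M[R]_(m, n)) (F : V -> 'cV[R]_n) x v dF :
  is_derive x v F dF -> is_derive x v (fun y => M *m F y) (M *m dF).
Proof.
exact: is_derive_linear_comp (@linear_cV_continuous _ _ _ (mulmx M)).
Qed.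

End MatrixValued.

Lemma is_derive_linear (R : realType) (m : nat) (W : normedModType R)
    (P : {linear 'cV[R]_m -> W}) x v : is_derive x v P (P v).
Proof.
exact: is_derive_linear_comp (@linear_cV_continuous _ _ _ P) (is_derive_id x v).
Qed.

(** Each coordinate is a linear map, hence commutes with both derivatives; this reduces the claim to
    the scalar case. *)
Lemma derive_comm_cV (R : realType) (V : normedModType R) n (G : V -> 'cV[R]_n)
    (u v z : V) : C2 G -> 'D_v ('D_u G) z = 'D_u ('D_v G) z.
Proof.
move=> c2G; apply/matrixP => i j; rewrite ord1.
have lin : linear (fun y : 'cV[R]_n => y i 0) by move=> k x y; rewrite !mxE.
pose P : {linear 'cV[R]_n -> R} := linear_pack lin.
have [[d _] c2] := c2G.
have d2 w : forall x, differentiable ('D_w G) x by case: (c2 w).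
have e w w' : 'D_w' ('D_w (P \o G)) z = P ('D_w' ('D_w G) z).
  rewrite (derive_postcomp P w d).
  by have /(congr1 (fun h : V -> R => h z)) := derive_postcomp P w' (d2 w).
by rewrite -[LHS](e u v) -[RHS](e v u); exact: derive_comm (C2_postcomp P c2G).
Qed.

Section Dotv.
Context {R : realType} {n : nat}.
Implicit Types u v w : 'cV[R]_n.

Lemma dotvE u v : dotv u v = \sum_k u k 0 * v k 0.
Proof. by rewrite /dotv mxE; apply: eq_bigr => k _; rewrite mxE. Qed.

Lemma dotvC u v : dotv u v = dotv v u.
Proof. by rewrite !dotvE; apply: eq_bigr => k _; rewrite mulrC. Qed.

Lemma dotvDr u v w : dotv u (v + w) = dotv u v + dotv u w.
Proof. by rewrite /dotv mulmxDr mxE. Qed.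

Lemma dotvNr u v : dotv u (- v) = - dotv u v.
Proof. by rewrite /dotv mulmxN mxE. Qed.

Lemma dotvZr k u v : dotv u (k *: v) = k * dotv u v.
Proof. by rewrite /dotv -scalemxAr mxE. Qed.

Lemma dotv0 u : dotv u 0 = 0.
Proof. by rewrite /dotv mulmx0 mxE. Qed.

Lemma dot0v u : dotv 0 u = 0.
Proof. by rewrite dotvC dotv0. Qed.

Lemma dotv_delta (j : 'I_n) v : dotv (delta_mx j 0) v = v j 0.
Proof.
rewrite dotvE (bigD1 j)//= big1 => [|k /negPf kj]; rewrite mxE ?kj ?mul0r//.
by rewrite !eqxx mul1r addr0.
Qed.

Lemma sqnorm_mxE (E : 'M[R]_n) v : sqnorm_mx E v = dotv v (E *m v).
Proof. by rewrite /sqnorm_mx /dotv mulmxA. Qed.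

End Dotv.

Lemma dotv_mulmx (R : realType) m n (M : 'M[R]_(m, n)) (u : 'cV[R]_m) v :
  dotv u (M *m v) = dotv (M^T *m u) v.
Proof. by rewrite /dotv trmx_mul trmxK mulmxA. Qed.

Lemma dotv_trmulmx (R : realType) m n (M : 'M[R]_(m, n)) u v :
  dotv u (M^T *m v) = dotv (M *m u) v.
Proof. by rewrite dotv_mulmx trmxK. Qed.

Lemma dotv_sym_mulmx (R : realType) n (E : 'M[R]_n) u v :
  E^T = E -> dotv u (E *m v) = dotv v (E *m u).
Proof. by move=> symE; rewrite dotv_mulmx symE dotvC. Qed.

(** Symmetry of [E] makes the two terms of the product rule equal, and the factor 1/2 absorbs the
    resulting 2. *)
Lemma is_derive_half_sqnorm (R : realType) (V : normedModType R) n
    (E : 'M[R]_n) (c : 'cV[R]_n) (F : V -> 'cV[R]_n) x v dF :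
  E^T = E -> is_derive x v F dF ->
  is_derive x v (fun y => 2^-1 * (sqnorm_mx E (F y - c) - 1))
    (dotv dF (E *m (F x - c))).
Proof.
move=> symE hF.
have hFc : is_derive x v (fun y => F y - c) dF.
  apply: is_derive_eq (is_deriveB hF (is_derive_cst c x v)) _.
  by rewrite subr0.
have -> : (fun y => 2^-1 * (sqnorm_mx E (F y - c) - 1)) =
    (fun y => 2^-1 * (dotv (F y - c) (E *m (F y - c)) - 1)).
  by apply/funext => y; rewrite sqnorm_mxE.
have h := is_deriveB (is_derive_dotv hFc (is_derive_mulmx E hFc))
  (is_derive_cst (1 : R) x v).
apply: is_derive_eq (is_deriveZ 2^-1 h) _.
rewrite subr0 [X in _ + X]dotv_sym_mulmx//.
by rewrite [LHS]mulrDr mulrC -splitr.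
Qed.

Lemma derive_jacobian (R : realType) m n (f : 'cV[R]_m -> 'cV[R]_n) x v :
  differentiable f x -> 'D_v f x = jacobian_mx f x *m v.
Proof.
move=> df; rewrite deriveE// {1}[v]matrix_sum_delta linear_sum.
apply/matrixP => i j; rewrite ord1 summxE mxE; apply: eq_bigr => k _.
rewrite big_ord1 linearZ mxE -deriveE// derive_mx ?mxE; last exact: diff_derivable.
by rewrite mulrC.
Qed.

(** * First and second derivatives of the Lagrangian of one segment *)

Lemma usubmx_is_linear (R : pzRingType) m1 m2 n :
  linear (@usubmx R m1 m2 n).
Proof. by move=> k x y; apply/matrixP => i j; rewrite !mxE. Qed.

Lemma dsubmx00_is_linear (R : realType) m :
  linear (fun z : 'cV[R]_(m + 1) => dsubmx z 0 0).
Proof. by move=> k x y; rewrite !mxE. Qed.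

(* The part of the Lagrangian that depends on z = [x; t]; [b] and [l] are the
   multipliers of the transitions into and out of the segment, and [a] and [m]
   those of the boundary constraints, each 0 where there is no such constraint. *)
Definition seg_lagrangian (R : realType) (n : nat) (EI EU : 'M[R]_n)
    (cI cU : 'cV[R]_n) (G : 'cV[R]_(n + 1) -> 'cV[R]_n) (a : R) (b l : 'cV[R]_n)
    (m : R) (z : 'cV[R]_(n + 1)) : R :=
  2^-1 * (dsubmx z 0 0) ^+ 2
  + a * (2^-1 * (sqnorm_mx EI (usubmx z - cI) - 1))
  + dotv b (usubmx z)
  - dotv l (G z)
  + m * (2^-1 * (sqnorm_mx EU (G z - cU) - 1)).

Section SegmentDerivatives.
Context {R : realType} {n : nat}.
Variables (EI EU : 'M[R]_n) (cI cU : 'cV[R]_n).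
Variables (G : 'cV[R]_(n + 1) -> 'cV[R]_n).
Hypotheses (symEI : EI^T = EI) (symEU : EU^T = EU) (c2G : C2 G).
Variables (a : R) (b l : 'cV[R]_n) (m : R).

Let g := seg_lagrangian EI EU cI cU G a b l m.

Let dG u z : is_derive z u G ('D_u G z).
Proof. by apply: derivableP; apply: diff_derivable; case: c2G => -[]. Qed.

Let ddG u w z : is_derive z w ('D_u G) ('D_w ('D_u G) z).
Proof. by apply: derivableP; apply: diff_derivable; case: c2G => _ /(_ u)[]. Qed.

Let dusub (w z : 'cV[R]_(n + 1)) : is_derive z w (@usubmx R n 1 1) (usubmx w).
Proof. exact: (is_derive_linear (linear_pack (@usubmx_is_linear R n 1 1))). Qed.

Let ddsub (w z : 'cV[R]_(n + 1)) :
  is_derive z w (fun y : 'cV[R]_(n + 1) => dsubmx y 0 0) (dsubmx w 0 0).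
Proof. exact: (is_derive_linear (linear_pack (@dsubmx00_is_linear R n))). Qed.

Let dotv_const (c : 'cV[R]_n) F (z w : 'cV[R]_(n + 1)) dF :
  is_derive z w F dF -> is_derive z w (fun y => dotv c (F y)) (dotv c dF).
Proof.
move=> hF; apply: is_derive_eq (is_derive_dotv (is_derive_cst c z w) hF) _.
by rewrite dot0v add0r.
Qed.

Let dmulmx_sub (E : 'M[R]_n) (c : 'cV[R]_n) (F : 'cV[R]_(n + 1) -> 'cV[R]_n)
    (z w : 'cV[R]_(n + 1)) (dF : 'cV[R]_n) :
  is_derive z w F dF -> is_derive z w (fun y => E *m (F y - c)) (E *m dF).
Proof.
move=> hF; have := is_derive_mulmx E (is_deriveB hF (is_derive_cst c z w)).
by rewrite subr0.
Qed.

(** The form [is_derive] gives the value, to be differentiated again, together with the derivability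
    that [hessian_block_sum] asks for. *)
Lemma is_derive_seg_lagrangian u z : is_derive z u g
  (dsubmx u 0 0 * dsubmx z 0 0 + a * dotv (usubmx u) (EI *m (usubmx z - cI))
   + dotv b (usubmx u) - dotv l ('D_u G z)
   + m * dotv ('D_u G z) (EU *m (G z - cU))).
Proof.
have h1 : is_derive z u (fun y : 'cV[R]_(n + 1) => 2^-1 * (dsubmx y 0 0) ^+ 2)
    (dsubmx u 0 0 * dsubmx z 0 0).
  apply: is_derive_eq (is_deriveZ 2^-1 (is_deriveX 2 (ddsub u z))) _.
  rewrite /GRing.scale/= expr1 mulrA mulKf// mulrC//.
have h2 := is_deriveZ a (is_derive_half_sqnorm cI symEI (dusub u z)).
have h5 := is_deriveZ m (is_derive_half_sqnorm cU symEU (dG u z)).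
exact: is_deriveD (is_deriveB (is_deriveD (is_deriveD h1 h2)
  (dotv_const b (dusub u z))) (dotv_const l (dG u z))) h5.
Qed.

Lemma is_derive2_seg_lagrangian u w z : is_derive z w ('D_u g)
  (dsubmx u 0 0 * dsubmx w 0 0 + a * dotv (usubmx u) (EI *m usubmx w)
   - dotv l ('D_w ('D_u G) z)
   + m * (dotv ('D_w ('D_u G) z) (EU *m (G z - cU))
          + dotv ('D_u G z) (EU *m 'D_w G z))).
Proof.
have -> : 'D_u g = fun z =>
    (dsubmx u 0 0 * dsubmx z 0 0 + a * dotv (usubmx u) (EI *m (usubmx z - cI))
     + dotv b (usubmx u) - dotv l ('D_u G z)
     + m * dotv ('D_u G z) (EU *m (G z - cU))).
  by apply/funext => y; case: (is_derive_seg_lagrangian u y).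
have h1 := is_deriveZ (dsubmx u 0 0) (ddsub w z).
have h2 := is_deriveZ a
  (dotv_const (usubmx u) (dmulmx_sub EI cI (dusub w z))).
(* The incoming transition contributes linearly in [z], so its first derivative is constant: this is
   why block i contains no lambda_{i-1}. *)
have h3 := is_derive_cst (dotv b (usubmx u)) z w.
have h4 := dotv_const l (ddG u w z).
have h5 := is_deriveZ m (is_derive_dotv (ddG u w z) (dmulmx_sub EU cU (dG w z))).
have := is_deriveD (is_deriveB (is_deriveD (is_deriveD h1 h2) h3) h4) h5.
by rewrite addr0.
Qed.

End SegmentDerivatives.

(** * The flow as a function of state and time, and the Hessian of one segment *)

(** Taking the single argument [[x; t]] makes state and time derivatives directional derivatives of
    one C^2 map. *)
Definition joint_flow (R : realType) (n : nat) (Phi : R -> 'cV[R]_n -> 'cV[R]_n)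
    (z : 'cV[R]_(n + 1)) : 'cV[R]_n :=
  Phi (dsubmx z 0 0) (usubmx z).

Section JointFlow.
Context {R : realType} {n : nat}.
Variables (f : 'cV[R]_n -> 'cV[R]_n) (Phi : R -> 'cV[R]_n -> 'cV[R]_n).
Hypotheses (c1f : C1 f) (flowPhi : is_flow f Phi) (c2G : C2 (joint_flow Phi)).

Let G := joint_flow Phi.
Let dir_t : 'cV[R]_(n + 1) := delta_mx (rshift n ord0) 0.
Let dir_x (w : 'cV[R]_n) : 'cV[R]_(n + 1) := col_mx w 0.

Let diffG z : differentiable G z. Proof. by case: c2G => -[]. Qed.
Let diffDG u z : differentiable ('D_u G) z. Proof. by case: c2G => _ /(_ u)[]. Qed.

(** Embeds the state space at frozen time. As it is affine in [y], derivatives of [Phi t] become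
    derivatives of [G] along [dir_x]. *)
Let slice (t : R) (y : 'cV[R]_n) : 'cV[R]_(n + 1) := col_mx y t%:M.

Let joint_slice t : G \o slice t = Phi t.
Proof.
by apply/funext => y; rewrite /G /joint_flow /slice /= col_mxKu col_mxKd mxE eqxx.
Qed.

Let slice_affine t (y w : 'cV[R]_n) h :
  slice t (h *: w + y) = h *: dir_x w + slice t y.
Proof. by rewrite /slice /dir_x scale_col_mx add_col_mx scaler0 add0r. Qed.

Let sliceK z : slice (dsubmx z 0 0) (usubmx z) = z.
Proof. by rewrite /slice -mx11_scalar vsubmxK. Qed.

Lemma derive_flow_state t y w :
  is_derive y w (Phi t) ('D_(dir_x w) G (slice t y)).
Proof.
rewrite -[X in is_derive _ _ X](joint_slice t).
apply: is_derive_comp_affine (slice_affine t y w) _.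
exact/derivableP/diff_derivable.
Qed.

Lemma differentiable_flow_state t y : differentiable (Phi t) y.
Proof.
rewrite -(joint_slice t); apply: differentiable_comp; last exact: diffG.
have lin : linear dir_x.
  by move=> k u v; rewrite /dir_x scale_col_mx add_col_mx scaler0 addr0.
have -> : slice t = (linear_pack lin : 'cV[R]_n -> _) + cst (slice t 0).
  apply/funext => u; rewrite -[u in LHS]addr0 -[u in LHS]scale1r slice_affine.
  by rewrite scale1r.
apply: differentiableD => //; exact: linear_cV_differentiable.
Qed.

Lemma derive_joint_state z w :
  'D_(dir_x w) G z = sensitivity Phi (dsubmx z 0 0) (usubmx z) *m w.
Proof.
rewrite -derive_jacobian; last exact: differentiable_flow_state.
by case: (derive_flow_state (dsubmx z 0 0) (usubmx z) w) => _ ->; rewrite sliceK.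
Qed.

(** Along [dir_t] the state stays frozen, so the curve is a trajectory and the flow equation gives
    its velocity. *)
Lemma derive_joint_time : 'D_dir_t G = f \o G.
Proof.
apply/funext => z; pose l (s : R) := slice s (usubmx z).
have hl h : l (h *: 1 + dsubmx z 0 0) = h *: dir_t + l (dsubmx z 0 0).
  rewrite /l /slice /dir_t delta_mx_dshift scale_col_mx add_col_mx scaler0 add0r.
  congr col_mx; apply/matrixP => i j.
  by rewrite !ord1 !mxE !eqxx.
have := derive_comp_affine G hl.
have -> : G \o l = Phi^~ (usubmx z).
  by apply/funext => s; rewrite /l -[LHS]/((G \o slice s) _) joint_slice.
rewrite /l sliceK => <-.
by case: (flowPhi (usubmx z)) => _ /(_ (dsubmx z 0 0)) [].
Qed.

(** With the time derivative taken first, only a first derivative of [f] enters, and C^1 regularity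
    of [f] suffices. *)
Lemma derive2_joint_time z w :
  'D_w ('D_dir_t G) z = jacobian_mx f (G z) *m 'D_w G z.
Proof.
have df := c1f.1 (G z); have dG := diffG z.
rewrite derive_joint_time -(derive_jacobian _ df).
apply: etrans (deriveE w (differentiable_comp dG df)) _.
rewrite diff_comp//.
have -> := deriveE w dG.
by have -> := deriveE ('d G z w) df.
Qed.

(** Passing twice through the slice at frozen time turns second state derivatives of [Phi t] into
    those of [G]. *)
Lemma tensor_contract_flow z (w : 'cV[R]_n) i j :
  tensor_contract (hessian_tensor (Phi (dsubmx z 0 0)) (usubmx z)) w i j
  = dotv w ('D_(dir_x (delta_mx i 0)) ('D_(dir_x (delta_mx j 0)) G) z).
Proof.
set t := dsubmx z 0 0; rewrite /tensor_contract summxE dotvE; apply: eq_bigr => k _.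
rewrite !mxE; congr (_ * _).
have -> : 'D_(delta_mx j 0) (fun y => Phi t y k 0) =
    fun y => ('D_(dir_x (delta_mx j 0)) G \o slice t) y k 0.
  apply/funext => y.
  by case: (is_derive_coord k 0 (derive_flow_state t y (delta_mx j 0))).
have h : is_derive (slice t (usubmx z)) (dir_x (delta_mx i 0))
    ('D_(dir_x (delta_mx j 0)) G)
    ('D_(dir_x (delta_mx i 0)) ('D_(dir_x (delta_mx j 0)) G) (slice t (usubmx z))).
  exact/derivableP/diff_derivable.
case: (is_derive_coord k 0 (is_derive_comp_affine (slice_affine _ _ _) h)) => _ ->.
by rewrite sliceK.
Qed.

Variables (EI EU : 'M[R]_n) (cI cU : 'cV[R]_n).
Hypotheses (symEI : EI^T = EI) (symEU : EU^T = EU).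
Variables (a : R) (b l : 'cV[R]_n) (m : R).

Let g := seg_lagrangian EI EU cI cU G a b l m.

(** Every term of the second derivative formula is symmetric in the two directions: products by
    commutativity, the quadratic terms by symmetry of [EI] and [EU], and the terms in the second
    derivative of [G] by [derive_comm_cV]. *)
Lemma tr_hessian_seg_lagrangian z : (hessian g z)^T = hessian g z.
Proof.
have sym u w : 'D_w ('D_u g) z = 'D_u ('D_w g) z.
  have d2 u' w' := @derive_val _ _ _ _ _ _ _
    (is_derive2_seg_lagrangian cI cU symEI symEU c2G a b l m u' w' z).
  apply: etrans (d2 u w) (etrans _ (esym (d2 w u))).
  have comb (p p' q q' s s' : R) (D D' r : 'cV[R]_n) :
      p = p' -> q = q' -> D = D' -> s = s' ->
      p + a * q - dotv l D + m * (dotv D r + s)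
      = p' + a * q' - dotv l D' + m * (dotv D' r + s').
    by move=> -> -> -> ->.
  apply: (comb _ _ _ _ _ _ _ _ _ (mulrC _ _) (dotv_sym_mulmx _ _ symEI)
    (derive_comm_cV u w z c2G)).
  exact: dotv_sym_mulmx.
by apply/matrixP => i j; rewrite mxE mxE [RHS]mxE.
Qed.

(** One formula serves all segments: the first, intermediate and last blocks arise by setting some
    of [a], [l], [m] to 0. *)
Lemma hessian_seg_lagrangian z :
  let x := usubmx z in let t := dsubmx z 0 0 in
  let S := sensitivity Phi t x in
  let Df := jacobian_mx f (Phi t x) in
  let D2Phi := hessian_tensor (Phi t) x in
  let fx := f (Phi t x) in
  let r := EU *m (Phi t x - cU) in
  let v := - ((Df *m S)^T *m l) + m *: ((Df *m S)^T *m r)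
           + m *: (S^T *m EU *m fx) in
  hessian g z = block_mx
    (a *: EI - tensor_contract D2Phi l + m *: (S^T *m EU *m S)
     + m *: tensor_contract D2Phi r)
    v v^T
    (- dotv (Df *m fx) l + m * dotv (Df *m fx) r + m * dotv fx (EU *m fx) + 1)%:M.
Proof.
move=> x t S Df D2Phi fx r v.
have d2 u w := @derive_val _ _ _ _ _ _ _
  (is_derive2_seg_lagrangian cI cU symEI symEU c2G a b l m u w z).
have usub_t : usubmx dir_t = 0 by rewrite /dir_t delta_mx_dshift col_mxKu.
have dsub_t : dsubmx dir_t 0 0 = 1.
  by rewrite /dir_t delta_mx_dshift col_mxKd mxE !eqxx.
have dirE (k : 'I_n) : delta_mx (lshift 1 k) 0 = dir_x (delta_mx k 0).
  by rewrite delta_mx_ushift.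
have usub_x w : usubmx (dir_x w) = w by rewrite col_mxKu.
have dsub_x w : dsubmx (dir_x w) 0 0 = 0 by rewrite col_mxKd mxE.
have entryE (M : 'M[R]_n) j k :
    M j k = dotv (delta_mx j 0) (M *m delta_mx k 0).
  by rewrite dotv_delta -colE mxE.
have Dx w : 'D_(dir_x w) G z = S *m w := derive_joint_state z w.
have Dt : 'D_dir_t G z = fx.
  by have /(congr1 (fun h => h z)) := derive_joint_time.
(* In this corner the column index is time, and [hessian] differentiates along the column index
   first, so [derive2_joint_time] applies. *)
have urE : ursubmx (hessian g z) = v.
  apply/matrixP => i j; rewrite ord1 {j} -[RHS]dotv_delta.
  rewrite 3!mxE dirE; apply: etrans (d2 dir_t (dir_x (delta_mx i 0))) _.
  rewrite derive2_joint_time dsub_x usub_t Dx Dt mulr0 dot0v mulr0 !add0r.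
  rewrite /v !dotvDr dotvNr !dotvZr -[S^T *m EU *m fx]mulmxA !dotv_trmulmx.
  rewrite [dotv l _]dotvC [dotv fx _]dotv_sym_mulmx// mulrDr addrA.
  by rewrite -[Df *m S *m _]mulmxA.
rewrite -[LHS]submxK; congr block_mx => //.
- apply/matrixP => i j.
  rewrite 3!mxE !dirE.
  apply: etrans (d2 (dir_x (delta_mx j 0)) (dir_x (delta_mx i 0))) _.
  rewrite dsub_x !usub_x !Dx mul0r add0r.
  have combE (A B C D : 'M[R]_n) : (a *: A - B + m *: C + m *: D) i j =
      a * A i j - B i j + m * C i j + m * D i j by rewrite !mxE.
  rewrite combE !tensor_contract_flow [EI i j]entryE dotv_sym_mulmx//.
  rewrite [(_ *m S) i j]entryE -!mulmxA dotv_trmulmx [dotv (S *m _) _]dotv_sym_mulmx//.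
  by rewrite mulrDr [m * _ + m * _]addrC addrA [dotv r _]dotvC.
- by rewrite -urE trmx_ursub tr_hessian_seg_lagrangian.
- rewrite [LHS]mx11_scalar; congr (_%:M).
  rewrite 3!mxE; apply: etrans (d2 dir_t dir_t) _.
  rewrite derive2_joint_time dsub_t usub_t Dt mulr1 dot0v mulr0 addr0.
  by rewrite [dotv l _]dotvC mulrDr [RHS]addrC !addrA.
Qed.

End JointFlow.

(** * The Hessian of a separable sum is block diagonal *)

Section BlockSum.
Context {R : realType} {K : nat} {p_ : 'I_K -> nat}.
Variable g : forall p, 'cV[R]_(p_ p) -> R.
Arguments g : clear implicits.
Hypotheses (dg : forall p (u z : 'cV[R]_(p_ p)), derivable (g p) z u)
  (ddg : forall p (u w z : 'cV[R]_(p_ p)), derivable ('D_u (g p)) z w).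

Let submxcol_affine p (a v : 'cV[R]_(\sum_i p_ i)) h :
  submxcol (h *: v + a) p = h *: submxcol v p + submxcol a p.
Proof. by apply/matrixP => i j; rewrite !mxE. Qed.

(** [tagnat.Rank p j] is the position in the stacked vector of entry [j] of block [p]. *)
Let submxcol_delta p (j : 'I_(p_ p)) :
  submxcol (delta_mx (tagnat.Rank p j) 0 : 'cV[R]_(\sum_i p_ i)) p = delta_mx j 0.
Proof.
apply/matrixP => i k; rewrite !mxE.
by rewrite -[tagnat.Rank _ _ == _]val_eqE tagnat.eq_Rank eqxx val_eqE.
Qed.

Let submxcol_delta_neq p q (j : 'I_(p_ p)) : q != p ->
  submxcol (delta_mx (tagnat.Rank p j) 0 : 'cV[R]_(\sum_i p_ i)) q = 0.
Proof.
move=> /negPf qp; apply/matrixP => i k; rewrite !mxE.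
by rewrite -[tagnat.Rank _ _ == _]val_eqE tagnat.eq_Rank qp.
Qed.

Lemma hessian_block_sum chi :
  hessian (fun x : 'cV[R]_(\sum_i p_ i) => \sum_i g i (submxcol x i)) chi
  = \mxdiag_i hessian (g i) (submxcol chi i).
Proof.
pose sub p (x : 'cV[R]_(\sum_i p_ i)) := submxcol x p.
have sumE (F : forall p, 'cV[R]_(p_ p) -> R) :
    (fun x => \sum_i F i (submxcol x i)) = \sum_i (F i \o sub i).
  by apply/funext => x; rewrite fct_sumE.
have Dsum (F : forall p, 'cV[R]_(p_ p) -> R) v x :
    (forall p z, derivable (F p) z (sub p v)) ->
    'D_v (fun x => \sum_i F i (submxcol x i)) x
    = \sum_i 'D_(sub i v) (F i) (submxcol x i).
  move=> dF; rewrite sumE.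
  have h i : is_derive x v (F i \o sub i) ('D_(sub i v) (F i) (sub i x)).
    apply: is_derive_comp_affine (submxcol_affine i x v) _.
    exact: derivableP.
  by case: (is_derive_sum h).
apply/mxblockP => p q; apply/matrixP => j k.
rewrite 2!mxE.
set u := delta_mx (tagnat.Rank q k) 0; set w := delta_mx (tagnat.Rank p j) 0.
have -> : 'D_u (fun x => \sum_i g i (submxcol x i)) =
    (fun x => \sum_i 'D_(sub i u) (g i) (submxcol x i)).
  by apply/funext => x; rewrite Dsum.
rewrite (Dsum (fun i => 'D_(sub i u) (g i)))//.
(* The outer direction [w] lies in block [p], so every other summand is differentiated along 0. *)
rewrite (bigD1 p)//= big1 ?addr0; last first.
  by move=> i ip; rewrite /sub /w (submxcol_delta_neq j ip) derive0.
rewrite /sub /w (submxcol_delta j) /mxdiag mxblockK.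
have [pq|pq] := eqVneq p q.
  (* The type of [k] depends on [q], so it is generalized before [q] is replaced by [p]; the cast
     inside [\mxdiag] then disappears. *)
  move: k @u; rewrite -pq => k u.
  by rewrite conform_mx_id mxE /u (submxcol_delta k).
(* Off the diagonal the inner direction vanishes in block [p], so the inner derivative is
   identically 0. *)
rewrite mxE /u (submxcol_delta_neq k pq).
have -> : 'D_0 (g p) = cst 0 by apply/funext => z; exact: derive0.
exact: derive_cst.
Qed.

End BlockSum.

(** * Regularity of the flow from that of the constraints *)

(** Place [z] in the first segment and 0 in all others: the first transition constraint becomes
    [- joint_flow Phi z]. The embedding and the negated projection on that constraint are linear, so
    C^2 passes to the flow. *)
Lemma C2_joint_flow (R : realType) (n K : nat) (hK : (0 < K)%N)
    (Phi : R -> 'cV[R]_n -> 'cV[R]_n) (EI EU : 'M[R]_n) (cI cU : 'cV[R]_n) :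
  C2 (fun chi : param_vec R n K => constraint_vec Phi EI EU cI cU chi) ->
  C2 (joint_flow Phi).
Proof.
move=> hc; pose i0 : 'I_K := Ordinal hK.
pose emb (z : 'cV[R]_(n + 1)) : param_vec R n K :=
  \mxcol_(i < K.+1) (if i == seg_from i0 then z else 0).
have emb_lin : linear emb.
  move=> k x y; apply/mxcolP => i; rewrite mxcolK.
  rewrite submxcolD [submxcol (k *: _) i](_ : _ = k *: submxcol (emb x) i).
    by rewrite !mxcolK; case: ifP => // _; rewrite scaler0 addr0.
  by apply/matrixP => r s; rewrite !mxE.
pose proj (c : multiplier_vec R n K) : 'cV[R]_n := - lamT c i0.
have proj_lin : linear proj.
  by move=> k x y; apply/matrixP => r s; rewrite !mxE opprD mulrN.
rewrite (_ : joint_flow Phi = (linear_pack proj_lin \o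
    (fun chi : param_vec R n K => constraint_vec Phi EI EU cI cU chi))
    \o linear_pack emb_lin); last first.
  apply/funext => z; rewrite /= /proj /lamT /constraint_vec /=.
  rewrite col_mxKd col_mxKu mxcolK /seg_len /seg_init /emb !mxcolK eqxx.
  have -> : (seg_next i0 == seg_from i0) = false by [].
  by rewrite (_ : usubmx 0 = 0) ?sub0r ?opprK//; apply/matrixP => r s; rewrite !mxE.
exact: C2_precomp (C2_postcomp (linear_pack proj_lin) hc).
Qed.

(** * Splitting the Lagrangian into segments *)

Lemma dotv_col_mx (R : realType) m1 m2 (u1 v1 : 'cV[R]_m1) (u2 v2 : 'cV[R]_m2) :
  dotv (col_mx u1 u2) (col_mx v1 v2) = dotv u1 v1 + dotv u2 v2.
Proof. by rewrite /dotv tr_col_mx mul_row_col mxE. Qed.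

Lemma dotv_mxcol (R : realType) (K n : nat) (u v : 'I_K -> 'cV[R]_n) :
  dotv (\mxcol_i u i) (\mxcol_i v i) = \sum_i dotv (u i) (v i).
Proof. by rewrite /dotv tr_mxcol mul_mxrow_mxcol summxE. Qed.

Lemma dotv_scalar (R : realType) (a b : R) :
  dotv (a%:M : 'cV[R]_1) b%:M = a * b.
Proof. by rewrite dotvE big_ord1 !mxE. Qed.

(** The four coefficients that follow supply the arguments [a], [b], [l], [m] of [seg_lagrangian] on
    segment [p]; the default 0 marks an absent constraint. *)
Definition coefI (R : realType) (n K : nat) (lam : multiplier_vec R n K)
    (p : 'I_K.+1) : R := if p == ord0 then lamI lam else 0.

Definition coef_in (R : realType) (n K : nat) (lam : multiplier_vec R n K)
    (p : 'I_K.+1) : 'cV[R]_n := if unlift ord0 p is Some i then lamT lam i else 0.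

(** Omitting [ord_max] matches segments with the transitions leaving them, since [seg_from i] is
    [lift ord_max i]; [coef_in] omits [ord0] likewise. *)
Definition coef_out (R : realType) (n K : nat) (lam : multiplier_vec R n K)
    (p : 'I_K.+1) : 'cV[R]_n :=
  if unlift ord_max p is Some i then lamT lam i else 0.

Definition coefU (R : realType) (n K : nat) (lam : multiplier_vec R n K)
    (p : 'I_K.+1) : R := if p == ord_max then lamU lam else 0.

Lemma seg_from_lift K (i : 'I_K) : seg_from i = lift ord_max i.
Proof. by apply/val_inj; rewrite [RHS]lift_max. Qed.

Lemma lagrangian_seg_sum (R : realType) (n K : nat)
    (Phi : R -> 'cV[R]_n -> 'cV[R]_n) (EI EU : 'M[R]_n) (cI cU : 'cV[R]_n)
    (chi : param_vec R n K) (lam : multiplier_vec R n K) :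
  lagrangian Phi EI EU cI cU chi lam =
  \sum_p seg_lagrangian EI EU cI cU (joint_flow Phi) (coefI lam p)
    (coef_in lam p) (coef_out lam p) (coefU lam p) (submxcol chi p).
Proof.
rewrite /lagrangian /constraint_vec -{1}[lam]vsubmxK -[dsubmx lam]vsubmxK.
rewrite [usubmx lam]mx11_scalar [dsubmx (dsubmx lam)]mx11_scalar.
rewrite -[usubmx (dsubmx lam)]submxcolK !dotv_col_mx dotv_mxcol !dotv_scalar.
rewrite /seg_lagrangian !big_split /= sumrN -!addrA; congr (_ + _).
  by rewrite /objective mulr_sumr.
congr (_ + _).
  rewrite (bigD1 ord0)//= /coefI eqxx [X in _ = _ + X]big1 ?addr0// => p /negPf ->.
  by rewrite mul0r.
rewrite !addrA; congr (_ + _); last first.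
  rewrite (bigD1 ord_max)//= /coefU eqxx [X in _ = _ + X]big1 ?addr0// => p /negPf ->.
  by rewrite mul0r.
(* The first segment has no incoming transition and the last no outgoing one; without these zero
   terms both sums run over the transitions. *)
rewrite [X in _ = X - _]big_ord_recl [X in _ = _ - X]big_ord_recr /=.
rewrite /coef_in /coef_out !unlift_none !dot0v add0r addr0 -sumrB.
apply: eq_bigr => i _; rewrite liftK -/(seg_from i) seg_from_lift liftK.
by rewrite dotvDr dotvNr -seg_from_lift.
Qed.

Lemma tensor_contract0 (R : realType) n (T : 'I_n -> 'M[R]_n) :
  tensor_contract T 0 = 0.
Proof. by rewrite /tensor_contract big1// => k _; rewrite mxE scale0r. Qed.

(** * Assembly of the blocks *)

Theorem theorem1 (R : realType) (n K : nat) (hN : (2 <= K.+1)%N)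
  (f : 'cV[R]_n -> 'cV[R]_n) (hf : C1 f)
  (Phi : R -> 'cV[R]_n -> 'cV[R]_n) (hPhi : is_flow f Phi)
  (EI EU : 'M[R]_n) (hEI : sym_posdef EI) (hEU : sym_posdef EU)
  (cI cU : 'cV[R]_n)
  (hF : C2 (fun chi : param_vec R n K => objective chi))
  (hc : C2 (fun chi : param_vec R n K => constraint_vec Phi EI EU cI cU chi))
  (chi : param_vec R n K) (ht : forall i : 'I_K.+1, 0 <= seg_len chi i)
  (lam : multiplier_vec R n K) :
  let x0 i := seg_init chi i in
  let t i := seg_len chi i in
  let xt i := Phi (t i) (x0 i) in
  let S i := sensitivity Phi (t i) (x0 i) in
  let Df i := jacobian_mx f (xt i) in
  let D2Phi i := hessian_tensor (Phi (t i)) (x0 i) in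
  let iN := ord_max : 'I_K.+1 in
  exists (A : 'I_K.+1 -> 'M[R]_n) (v : 'I_K.+1 -> 'cV[R]_n)
         (alpha : 'I_K.+1 -> R),
    hessian (fun chi' => lagrangian Phi EI EU cI cU chi' lam) chi
      = \mxdiag_(i < K.+1) block_mx (A i) (v i) (v i)^T (alpha i)%:M
    /\ (forall i : 'I_K,
          v (seg_from i) = - ((Df (seg_from i) *m S (seg_from i))^T *m lamT lam i))
    /\ (forall i : 'I_K,
          alpha (seg_from i)
            = - dotv (Df (seg_from i) *m f (xt (seg_from i))) (lamT lam i) + 1)
    /\ (forall i : 'I_K, i = 0%N :> nat ->
          A (seg_from i) = lamI lam *: EI - tensor_contract (D2Phi (seg_from i)) (lamT lam i))
    /\ (forall i : 'I_K, (0 < i)%N ->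
          A (seg_from i) = - tensor_contract (D2Phi (seg_from i)) (lamT lam i))
    /\ A iN
         = lamU lam *: ((S iN)^T *m EU *m S iN)
           + lamU lam *: tensor_contract (D2Phi iN) (EU *m (xt iN - cU))
    /\ v iN
         = lamU lam *: ((Df iN *m S iN)^T *m (EU *m (xt iN - cU)))
           + lamU lam *: ((S iN)^T *m EU *m f (xt iN))
    /\ alpha iN
         = lamU lam * dotv (Df iN *m f (xt iN)) (EU *m (xt iN - cU))
           + lamU lam * dotv (f (xt iN)) (EU *m f (xt iN))
           + 1.
Proof.
(* [hN] is convertible to [0 < K]: at least one transition exists. *)
have c2G := C2_joint_flow hN hc.
have [symEI _] := hEI; have [symEU _] := hEU.
move=> x0 t xt S Df D2Phi iN.
pose r i := EU *m (xt i - cU).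
(* The witnesses are the entries given by [hessian_seg_lagrangian] for the coefficients of segment
   [i]; the stated cases follow as these coefficients vanish. *)
pose v i := - ((Df i *m S i)^T *m coef_out lam i)
  + coefU lam i *: ((Df i *m S i)^T *m r i)
  + coefU lam i *: ((S i)^T *m EU *m f (xt i)).
pose A i := coefI lam i *: EI - tensor_contract (D2Phi i) (coef_out lam i)
  + coefU lam i *: ((S i)^T *m EU *m S i)
  + coefU lam i *: tensor_contract (D2Phi i) (r i).
pose alpha i := - dotv (Df i *m f (xt i)) (coef_out lam i)
  + coefU lam i * dotv (Df i *m f (xt i)) (r i)
  + coefU lam i * dotv (f (xt i)) (EU *m f (xt i)) + 1.
have from_coefU i : coefU lam (seg_from i) = 0.
  by rewrite /coefU seg_from_lift eq_sym (negPf (neq_lift _ _)).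
have from_coef_out i : coef_out lam (seg_from i) = lamT lam i.
  by rewrite /coef_out seg_from_lift liftK.
have last_coef_out : coef_out lam iN = 0 by rewrite /coef_out unlift_none.
have last_coefU : coefU lam iN = lamU lam by rewrite /coefU eqxx.
exists A, v, alpha; split.
  rewrite (_ : (fun _ => _) = fun x => \sum_p
      seg_lagrangian EI EU cI cU (joint_flow Phi) (coefI lam p)
        (coef_in lam p) (coef_out lam p) (coefU lam p) (submxcol x p)); last first.
    by apply/funext => x; exact: lagrangian_seg_sum.
  rewrite (hessian_block_sum (g := fun p => seg_lagrangian EI EU cI cU
      (joint_flow Phi) (coefI lam p) (coef_in lam p) (coef_out lam p)
      (coefU lam p))).
  - by apply: eq_mxdiag => p; exact: hessian_seg_lagrangian.
  - move=> p u z.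
    by case: (is_derive_seg_lagrangian cI cU symEI symEU c2G (coefI lam p)
      (coef_in lam p) (coef_out lam p) (coefU lam p) u z).
  - move=> p u w z.
    by case: (is_derive2_seg_lagrangian cI cU symEI symEU c2G (coefI lam p)
      (coef_in lam p) (coef_out lam p) (coefU lam p) u w z).
split=> [i|]; first by rewrite /v from_coefU from_coef_out !scale0r !addr0.
split=> [i|]; first by rewrite /alpha from_coefU from_coef_out !mul0r !addr0.
split=> [i i0|].
  rewrite /A from_coefU from_coef_out !scale0r !addr0 /coefI.
  by rewrite (_ : seg_from i == ord0)// -val_eqE /= i0.
split=> [i i0|].
  rewrite /A from_coefU from_coef_out !scale0r !addr0 /coefI.
  by rewrite -val_eqE /= gtn_eqF// scale0r add0r.
split.
  (* As N >= 2, the last segment is not the first, so [A iN] has no term in [EI]. *)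
  rewrite /A last_coefU last_coef_out tensor_contract0 subr0 /coefI.
  by rewrite -val_eqE /= gtn_eqF// scale0r add0r.
split; first by rewrite /v last_coefU last_coef_out mulmx0 oppr0 add0r.
by rewrite /alpha last_coefU last_coef_out dotv0 oppr0 add0r.
Qed.
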